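(* Let $r\geq 3$ and $k\geq 1$ be integers, let $n=kr+1$, and let $\mathcal{F}(n,r)=\binom{[n]}{2}\setminus\binom{[n]}{2}_{r\text{-stab}}$ be the family of all $2$-subsets of $[n]$ that are not $r$-stable. Then $$\chi\left(\mathrm{KG}^r\left(\mathcal{F}(n,r)_{r\text{-stab}}\right)\right)<\left\lceil\frac{cd_r\left(\mathcal{F}(n,r)\right)}{r-1}\right\rceil .$$ Consequently, the following assertion is false: for every $r\geq 3$ and every set system $\mathcal{F}$ on a ground set $[n]$, $\chi\left(\mathrm{KG}^r\left(\mathcal{F}_{r\text{-stab}}\right)\right)\geq\left\lceil\frac{cd_r(\mathcal{F})}{r-1}\right\rceil$.
   Context: $[n]=\{1,\ldots,n\}$ and $\binom{[n]}{2}$ is the set of all $2$-element subsets of $[n]$. A hypergraph $\mathcal{H}=(V,E)$ consists of a finite set $V$ of vertices and a set $E$ of non-empty subsets of $V$ called edges. An $m$-coloring of $\mathcal{H}$ is a map $c:V\to\{1,\ldots,m\}$ with no monochromatic edge, i.e. $|c(e)|\geq 2$ for all $e\in E$; $\mathcal{H}$ is $m$-colorable if it admits an $m$-coloring. The chromatic number $\chi(\mathcal{H})$ is the minimum integer $m\ge 0$ such that $\mathcal{H}$ is $m$-colorable (so it is $0$ for the hypergraph with no vertices). A set system $\mathcal{F}$ of subsets of $[n]$ is identified with the hypergraph $([n],\mathcal{F})$. For $r\geq 2$, the $r$-colorability defect $cd_r(\mathcal{H})$ is the minimum number of vertices that must be removed from $V$ so that the induced hypergraph on the remaining vertices (whose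 edges are the edges of $\mathcal{H}$ contained in the remaining vertex set) is $r$-colorable. For a set system $\mathcal{F}$, $\mathrm{KG}^r(\mathcal{F})$ is the $r$-uniform hypergraph whose vertices are the elements of $\mathcal{F}$ and whose edges are all sets $\{A_1,\ldots,A_r\}$ of $r$ vertices with $A_i\cap A_j=\emptyset$ for all $i\neq j$. A subset $\sigma\subseteq[n]$ is $s$-stable if $s\leq|i-j|\leq n-s$ for all distinct $i,j\in\sigma$. For a family $\mathcal{F}$ of subsets of $[n]$, $\mathcal{F}_{s\text{-stab}}$ denotes the set of all $s$-stable members of $\mathcal{F}$. *)

(* Defs.v *)
From HB Require Import structures.
From mathcomp Require Import all_boot all_order all_algebra.

Set Implicit Arguments.
Unset Strict Implicit.
Unset Printing Implicit Defensive.

(* The vertex set is the whole finite type V, so that a coloring is a total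
   function on V and the hypergraph without vertices is 0-colorable. *)
Record hypergraph (V : finType) := Hypergraph {
  edges : {set {set V}};
  edges_nonempty : set0 \notin edges
}.

Definition is_coloring (V : finType) (H : hypergraph V) (m : nat)
    (c : {ffun V -> 'I_m}) : bool :=
  [forall e in edges H, 2 <= #|c @: e|].

Definition colorable (V : finType) (H : hypergraph V) (m : nat) : bool :=
  [exists c : {ffun V -> 'I_m}, is_coloring H c].

(* Only m <= #|V| has to be searched; chromatic_numberP shows that this is the
   least m such that H is m-colorable. A hypergraph with a singleton edge is
   not m-colorable for any m, and the value #|V| is then meaningless. *)
Definition chromatic_number (V : finType) (H : hypergraph V) : nat :=
  [arg min_(m < ord_max : 'I_#|V|.+1 | colorable H m) m].

Lemma edges_induced_nonempty (V : finType) (H : hypergraph V) (W : {set V}) :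
  set0 \notin [set e : {set {x : V | x \in W}} | val @: e \in edges H].
Proof. by rewrite inE imset0 edges_nonempty. Qed.

Definition induced (V : finType) (H : hypergraph V) (W : {set V}) :
    hypergraph {x : V | x \in W} :=
  Hypergraph (edges_induced_nonempty H W).

(* Removing all the vertices always works, hence the default value setT. *)
Definition colorability_defect (r : nat) (V : finType) (H : hypergraph V)
    : nat :=
  #|[arg min_(S < [set: V] | colorable (induced H (~: S)) r) #|S| ]|.

(* A set system on [n] is a hypergraph on 'I_n; 'I_n = {0, ..., n - 1} stands
   for [n] = {1, ..., n}, a shift that leaves the differences i - j unchanged. *)
Definition set_system (n : nat) := hypergraph 'I_n.

Definition stable (s n : nat) (A : {set 'I_n}) : bool :=
  [forall i in A, forall j in A, (i != j) ==>
     (s%:Z <= `|i%:Z - j%:Z| <= n%:Z - s%:Z)%R].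

Lemma stable_part_nonempty (s n : nat) (F : set_system n) :
  set0 \notin [set A in edges F | stable s A].
Proof. by rewrite inE (negbTE (edges_nonempty F)). Qed.

Definition stable_part (s n : nat) (F : set_system n) : set_system n :=
  Hypergraph (stable_part_nonempty s F).

Section Kneser.

Variables (r n : nat) (F : set_system n).

Let vertex : finType := {A : {set 'I_n} | A \in edges F}.

(* The condition e != set0 is redundant unless r = 0. *)
Definition kneser_edges : {set {set vertex}} :=
  [set e : {set vertex} | [&& e != set0, #|e| == r &
     [forall A in e, forall B in e, (A != B) ==> [disjoint val A & val B]]]].

Lemma kneser_edges_nonempty : set0 \notin kneser_edges.
Proof. by rewrite inE eqxx. Qed.

Definition kneser : hypergraph vertex := Hypergraph kneser_edges_nonempty.

End Kneser.

Lemma pairs_nonempty (n : nat) : set0 \notin [set A : {set 'I_n} | #|A| == 2].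
Proof. by rewrite inE cards0. Qed.

Definition pairs (n : nat) : set_system n := Hypergraph (pairs_nonempty n).

Lemma unstable_pairs_nonempty (n r : nat) :
  set0 \notin edges (pairs n) :\: edges (stable_part r (pairs n)).
Proof. by rewrite in_setD (negbTE (edges_nonempty (pairs n))) andbF. Qed.

Definition unstable_pairs (n r : nat) : set_system n :=
  Hypergraph (unstable_pairs_nonempty n r).

Lemma colorable_card (V : finType) (H : hypergraph V) (m : nat) :
  colorable H m -> colorable H #|V|.
Proof.
case/existsP=> c /forall_inP cP; apply/existsP.
exists [ffun x => enum_rank x]; apply/forall_inP=> e /cP.
rewrite (_ : [ffun x => enum_rank x] @: e = enum_rank @: e); last first.
  by apply: eq_imset => x; rewrite ffunE.
rewrite (card_imset _ enum_rank_inj) => /leq_trans; apply.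
exact: leq_imset_card.
Qed.

Lemma chromatic_numberP (V : finType) (H : hypergraph V) (m0 : nat) :
  colorable H m0 ->
  colorable H (chromatic_number H) /\
  (forall m, colorable H m -> chromatic_number H <= m).
Proof.
move=> /colorable_card Hmax; rewrite /chromatic_number.
case: arg_minnP => // i Hi imin; split=> // m Hm.
have [mV | Vm] := ltnP m #|V|.+1; first exact: (imin (Ordinal mV)).
by rewrite (leq_trans _ (ltnW Vm)) // -ltnS ltn_ord.
Qed.

Lemma colorability_defectP (r : nat) (V : finType) (H : hypergraph V) :
  (exists2 S : {set V}, colorable (induced H (~: S)) r &
     #|S| = colorability_defect r H) /\
  (forall S : {set V}, colorable (induced H (~: S)) r ->
     colorability_defect r H <= #|S|).
Proof.
rewrite /colorability_defect; case: arg_minnP => [|S HS Smin].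
  have noV (x : {x : V | x \in ~: [set: V]}) : False.
    by case: x => x; rewrite setCT inE.
  apply/existsP; exists (finfun (fun x => False_rect _ (noV x))).
  apply/forall_inP=> e He; have e0 : e = set0.
    by apply/setP=> x; case: (noV x).
  by move: He; rewrite e0 (negbTE (edges_nonempty _)).
by split; first exists S.
Qed.

(* Main.v *)
Require Import Defs.
From HB Require Import structures.
From mathcomp Require Import all_boot all_order all_algebra.
From mathcomp Require Import zify.

Set Implicit Arguments.
Unset Strict Implicit.
Unset Printing Implicit Defensive.

Import Order.TTheory GRing.Theory Num.Theory.

(** The family has no r-stable member, so the Kneser hypergraph has no vertex
and its chromatic number is 0; it remains to see that the defect is positive,
i.e. that the family is not r-colorable. Any r consecutive points are pairwise
unstable, so an r-coloring uses every color exactly once on each window of r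
consecutive points and is therefore r-periodic. Hence 0 and kr = n - 1 get the
same color, although they are cyclically adjacent. *)

Lemma chromatic_number_card0 (V : finType) (H : hypergraph V) :
  #|V| = 0 -> chromatic_number H = 0.
Proof.
(* The minimum is taken over ['I_#|V|.+1], so its value is at most [#|V|], whether or not [H] is
   colorable. *)
move=> V0; apply/eqP; rewrite -leqn0 -V0 -ltnS /chromatic_number.
exact: ltn_ord.
Qed.

(** An optimal set of removed vertices is empty, so the remaining vertices form a copy of [V], and
    the coloring is pulled back along the bijection [inj]. *)
Lemma colorability_defect_eq0 (r : nat) (V : finType) (H : hypergraph V) :
  colorability_defect r H = 0 -> colorable H r.
Proof.
move=> H0; have [[S cS] + _] := colorability_defectP r H.
rewrite H0 => /cards0_eq S0; case/existsP: cS => c /forall_inP cP.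
have inW x : x \in ~: S by rewrite S0 setC0 inE.
pose inj x : {x : V | x \in ~: S} := exist _ x (inW x).
apply/existsP; exists [ffun x => c (inj x)]; apply/forall_inP => e eH.
rewrite (_ : _ @: e = c @: (inj @: e)); last first.
  by rewrite -imset_comp; apply: eq_imset => x; rewrite ffunE.
apply: cP; rewrite inE -imset_comp (eq_imset _ (g := id)) ?imset_id //.
Qed.

Lemma stable_part_unstable_pairs (n r : nat) :
  edges (stable_part r (unstable_pairs n r)) = set0.
Proof.
apply/setP => A; rewrite !inE.
by case: (#|A| == 2); case: (stable r A).
Qed.

(** The two alternatives are the two ways to violate stability: too close directly, or too close
    around the cycle. *)
Lemma unstable_pair_edge (n r : nat) (i j : 'I_n) :
  i < j -> (j - i < r) || (n - r < j - i) ->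
  [set i; j] \in edges (unstable_pairs n r).
Proof.
move=> ij hd; have nij : i != j by apply: contraTneq ij => ->; rewrite ltnn.
rewrite !inE cards2 nij /= andbT; apply/negP => /forall_inP/(_ i).
rewrite !inE eqxx => /(_ isT)/forall_inP/(_ j).
rewrite !inE eqxx orbT nij => /(_ isT) /=.
lia.
Qed.

Lemma coloring_pair (V : finType) (H : hypergraph V) (m : nat)
    (c : {ffun V -> 'I_m}) (x y : V) :
  is_coloring H c -> [set x; y] \in edges H -> c x != c y.
Proof.
move=> /forall_inP cP /cP; rewrite imsetU1 imset_set1 cards2.
by case: (c x != c y).
Qed.

Lemma window_injective_periodic (r N : nat) (f : nat -> 'I_r) :
  (forall p q, p < q < N -> q - p < r -> f p != f q) ->
  forall p, p + r < N -> f (p + r) = f p.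
Proof.
move=> finj p pN.
have winj : injective (fun t : 'I_r => f (p + t)).
  move=> s t /eqP fst; apply: val_inj => /=.
  have [hs ht] := (ltn_ord s, ltn_ord t).
  case: (ltngtP s t) => // hst; [|rewrite eq_sym in fst];
    by move: fst; apply: contraTeq => _; apply: finj; lia.
(* An injective self-map of ['I_r] is onto, so the color of [p + r] already occurs at some [p + t]
   with [t < r]. *)
have := injF_onto winj (f (p + r)); case/codomP => t ft.
have ht := ltn_ord t.
have [t0 | t_gt0] := posnP t; first by rewrite ft t0 addn0.
(* For [t > 0] the points [p + t] and [p + r] are at distance [r - t < r], so their colors
   differ. *)
have /eqP[] : f (p + t) != f (p + r) by apply: finj; lia.
by rewrite ft.
Qed.

Lemma unstable_pairs_not_colorable (r k : nat) :
  2 <= r -> 1 <= k -> ~~ colorable (unstable_pairs (k * r).+1 r) r.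
Proof.
move=> r2 k1; apply/existsP => -[c cP].
pose f p := c (inord p : 'I_(k * r).+1).
have fE p q : p < q < (k * r).+1 ->
    (q - p < r) || ((k * r).+1 - r < q - p) -> f p != f q.
  case/andP=> pq qN hd; apply: (coloring_pair cP).
  by apply: unstable_pair_edge; rewrite !inordK // (ltn_trans pq).
have fper := @window_injective_periodic r (k * r).+1 f
  (fun p q pq d => fE p q pq (introT orP (or_introl d))).
have f0 j : j <= k -> f (j * r) = f 0.
  elim: j => [|j IHj] jk //.
  have jr : j.+1 * r <= k * r by rewrite leq_mul2r jk orbT.
  by rewrite mulSnr fper -?mulSnr // IHj // ltnW.
have kr : r <= k * r by rewrite leq_pmull.
(* The second alternative applies: [k * r] exceeds [k * r + 1 - r] because [r >= 2]. *)
have /eqP[] : f 0 != f (k * r) by apply: fE; lia.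
by rewrite f0.
Qed.

Theorem mainTheorem1 :
  (forall r k n : nat, 3 <= r -> 1 <= k -> n = k * r + 1 ->
     ((chromatic_number (kneser r (stable_part r (unstable_pairs n r))))%:Z
      < Num.ceil ((colorability_defect r (unstable_pairs n r))%:R
                  / (r%:R - 1) : rat))%R)
  /\
  ~ (forall r : nat, 3 <= r -> forall (n : nat) (F : set_system n),
       ((chromatic_number (kneser r (stable_part r F)))%:Z
        >= Num.ceil ((colorability_defect r F)%:R / (r%:R - 1) : rat))%R).
Proof.
have lt_ceil (r k n : nat) : 3 <= r -> 1 <= k -> n = k * r + 1 ->
     ((chromatic_number (kneser r (stable_part r (unstable_pairs n r))))%:Z
      < Num.ceil ((colorability_defect r (unstable_pairs n r))%:R
                  / (r%:R - 1) : rat))%R.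
  move=> r3 k1 ->; rewrite addn1 chromatic_number_card0; last first.
    apply: eq_card0 => -[A AF]; exfalso.
    by move: AF; rewrite stable_part_unstable_pairs inE.
  (* The left side is now 0 and [r - 1 > 0], so a positive defect suffices. *)
  rewrite ceil_gt0 divr_gt0 ?subr_gt0 ?ltr1n ?(ltn_trans _ r3) //.
  rewrite ltr0n lt0n; apply: contraNneq (unstable_pairs_not_colorable (ltnW r3) k1).
  exact: colorability_defect_eq0.
(* The instance [r = 3], [k = 1], [n = 4] refutes the general bound. *)
split=> // /(_ 3 isT 4 (unstable_pairs 4 3)).
by rewrite leNgt (lt_ceil 3 1 4).
Qed.
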